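(* Let $\mathcal{C}$ be a modular category of rank $r$ and let $\rho:\mathrm{SL}(2,\mathbb{Z})\to \mathrm{GL}_r(\mathbb{C})$ be a modular representation of $\mathcal{C}$. Then $\rho$ cannot be isomorphic to a direct sum of two (nonzero) representations of $\mathrm{SL}(2,\mathbb{Z})$ with disjoint $\mathfrak{t}$-spectra. In particular, if $\rho$ is non-degenerate, then it is absolutely irreducible.
   Context: A modular category $\mathcal{C}$ is a ribbon fusion category over $\mathbb{C}$ with invertible $S$-matrix; its rank $r$ is the number of isomorphism classes of simple objects. $S=(S_{ij})$ is the matrix of Hopf link invariants of pairs of simple objects (with $S_{0j}=d_j$ the quantum dimension, $0$ the unit object), and $T=\operatorname{diag}(\theta_i)$ is the diagonal matrix of twists. Let $\mathfrak{s}=\begin{pmatrix}0&-1\\1&0\end{pmatrix}$, $\mathfrak{t}=\begin{pmatrix}1&1\\0&1\end{pmatrix}$ be the standard generators of $\mathrm{SL}(2,\mathbb{Z})$. The assignment $\mathfrak{s}\mapsto S$, $\mathfrak{t}\mapsto T$ defines a projective representation of $\mathrm{SL}(2,\mathbb{Z})$; a modular representation of $\mathcal{C}$ is a linear representation $\rho$ lifting it, i.e. $\rho(\mathfrak{s})$ is a scalar multiple of $S$ and $\rho(\mathfrak{t})$ is a scalar multiple of $T$. The $\mathfrak{t}$-spectrum of a representation $\rho$ is the set of eigenvalues of $\rho(\mathfrak{t})$. A degree $r$ representation $\rho$ is non-degenerate if the $r$ eigenvalues of $\rho(\mathfrak{t})$ are distinct. *)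

(* Defs.v *)
From HB Require Import structures.
From mathcomp Require Import all_boot all_order all_algebra.

Set Implicit Arguments.
Unset Strict Implicit.
Unset Printing Implicit Defensive.

Import GRing.Theory.
Local Open Scope ring_scope.

(* Hom-spaces are [vectType]s: they are finite-dimensional by construction. *)
Record linear_category (K : fieldType) := LinearCategory {
  obj :> Type;
  Hom : obj -> obj -> vectType K;
  idm : forall X : obj, Hom X X;
  cmp : forall X Y Z : obj, Hom Y Z -> Hom X Y -> Hom X Z;
  cmpA : forall (W X Y Z : obj) (h : Hom Y Z) (g : Hom X Y) (f : Hom W X),
    cmp h (cmp g f) = cmp (cmp h g) f;
  cmp1m : forall (X Y : obj) (f : Hom X Y), cmp (idm Y) f = f;
  cmpm1 : forall (X Y : obj) (f : Hom X Y), cmp f (idm X) = f;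
  cmp_linearl : forall (X Y Z : obj) (a : K) (g g' : Hom Y Z) (f : Hom X Y),
    cmp (a *: g + g') f = a *: cmp g f + cmp g' f;
  cmp_linearr : forall (X Y Z : obj) (a : K) (g : Hom Y Z) (f f' : Hom X Y),
    cmp g (a *: f + f') = a *: cmp g f + cmp g f'
}.

Arguments Hom {K C} X Y : rename.
Arguments idm {K C} X : rename.
Arguments cmp {K C X Y Z} g f : rename.

Notation "g \oc f" := (cmp g f) (at level 50, left associativity).

Section LinearCategory.
Context {K : fieldType} {C : linear_category K}.
Implicit Types W X Y Z : C.

Definition is_iso X Y (f : Hom X Y) : Prop :=
  exists g : Hom Y X, g \oc f = idm X /\ f \oc g = idm Y.

Definition isomorphic X Y : Prop := exists f : Hom X Y, is_iso f.

Definition mono X Y (f : Hom X Y) : Prop :=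
  forall W (g h : Hom W X), f \oc g = f \oc h -> g = h.

Definition epi X Y (f : Hom X Y) : Prop :=
  forall Z (g h : Hom Y Z), g \oc f = h \oc f -> g = h.

Definition is_kernel X Y Z (f : Hom X Y) (k : Hom Z X) : Prop :=
  f \oc k = 0 /\
  forall W (g : Hom W X), f \oc g = 0 -> exists! u : Hom W Z, k \oc u = g.

Definition is_cokernel X Y Z (f : Hom X Y) (c : Hom Y Z) : Prop :=
  c \oc f = 0 /\
  forall W (g : Hom Y W), g \oc f = 0 -> exists! u : Hom Z W, u \oc c = g.

(* For n = 0 this says that S is a zero object. *)
Definition is_direct_sum n (Y : 'I_n -> C) (S : C) : Prop :=
  exists (i : forall k, Hom (Y k) S) (p : forall k, Hom S (Y k)),
    [/\ forall k, p k \oc i k = idm (Y k),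
        forall k l, k != l -> p k \oc i l = 0
      & \sum_(k < n) (i k \oc p k) = idm S].

Definition is_zero X : Prop := idm X = 0.

Definition simple X : Prop :=
  ~ is_zero X /\
  forall Y (f : Hom Y X), mono f -> is_zero Y \/ is_iso f.

(* Representatives of the isomorphism classes of simple objects, in an
   arbitrary order: in particular r is the number of these classes. *)
Definition simple_representatives r (X : 'I_r -> C) : Prop :=
  [/\ forall i, simple (X i),
      forall i j, isomorphic (X i) (X j) -> i = j
    & forall Y, simple Y -> exists i, isomorphic Y (X i)].

(* The scalar a such that f = a *: idm X, when there is one.  There is one if X
   is simple and K is algebraically closed (Schur's lemma). *)
Definition scalar_of X (f : Hom X X) : K := coord [tuple idm X] ord0 f.

End LinearCategory.

Record abelian (K : fieldType) (C : linear_category K) : Prop := Abelian {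
  ab_sum : forall n (Y : 'I_n -> C), exists S : C, is_direct_sum Y S;
  ab_ker : forall (X Y : C) (f : Hom X Y),
    exists (Z : C) (k : Hom Z X), is_kernel f k;
  ab_coker : forall (X Y : C) (f : Hom X Y),
    exists (Z : C) (c : Hom Y Z), is_cokernel f c;
  ab_mono : forall (X Y : C) (k : Hom X Y), mono k ->
    exists (Z : C) (f : Hom Y Z), is_kernel f k;
  ab_epi : forall (X Y : C) (c : Hom X Y), epi c ->
    exists (Z : C) (f : Hom Z X), is_cokernel f c
}.

Definition semisimple (K : fieldType) (C : linear_category K) : Prop :=
  forall X : C, exists n (Y : 'I_n -> C),
    (forall k, simple (Y k)) /\ is_direct_sum Y X.

Record monoidal_category (K : fieldType) := MonoidalCategory {
  mcat :> linear_category K;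
  unit_obj : mcat;
  tens : mcat -> mcat -> mcat;
  tensm : forall X X' Y Y' : mcat,
    Hom X X' -> Hom Y Y' -> Hom (tens X Y) (tens X' Y');
  tensm1 : forall X Y : mcat, tensm (idm X) (idm Y) = idm (tens X Y);
  tensm_cmp : forall (X X' X'' Y Y' Y'' : mcat) (f' : Hom X' X'') (f : Hom X X')
      (g' : Hom Y' Y'') (g : Hom Y Y'),
    tensm (f' \oc f) (g' \oc g) = tensm f' g' \oc tensm f g;
  tensm_linearl : forall (X X' Y Y' : mcat) (a : K) (f f' : Hom X X')
      (g : Hom Y Y'),
    tensm (a *: f + f') g = a *: tensm f g + tensm f' g;
  tensm_linearr : forall (X X' Y Y' : mcat) (a : K) (f : Hom X X')
      (g g' : Hom Y Y'),
    tensm f (a *: g + g') = a *: tensm f g + tensm f g';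
  assoc : forall X Y Z : mcat, Hom (tens (tens X Y) Z) (tens X (tens Y Z));
  assocV : forall X Y Z : mcat, Hom (tens X (tens Y Z)) (tens (tens X Y) Z);
  assocK : forall X Y Z : mcat, assocV X Y Z \oc assoc X Y Z = idm _;
  assocVK : forall X Y Z : mcat, assoc X Y Z \oc assocV X Y Z = idm _;
  assoc_nat : forall (X X' Y Y' Z Z' : mcat)
      (f : Hom X X') (g : Hom Y Y') (h : Hom Z Z'),
    assoc X' Y' Z' \oc tensm (tensm f g) h =
    tensm f (tensm g h) \oc assoc X Y Z;
  lunit : forall X : mcat, Hom (tens unit_obj X) X;
  lunit_iso : forall X : mcat, is_iso (lunit X);
  lunit_nat : forall (X Y : mcat) (f : Hom X Y),
    lunit Y \oc tensm (idm unit_obj) f = f \oc lunit X;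
  runit : forall X : mcat, Hom (tens X unit_obj) X;
  runit_iso : forall X : mcat, is_iso (runit X);
  runit_nat : forall (X Y : mcat) (f : Hom X Y),
    runit Y \oc tensm f (idm unit_obj) = f \oc runit X;
  pentagon : forall W X Y Z : mcat,
    tensm (idm W) (assoc X Y Z) \oc assoc W (tens X Y) Z
      \oc tensm (assoc W X Y) (idm Z) =
    assoc W X (tens Y Z) \oc assoc (tens W X) Y Z;
  triangle : forall X Y : mcat,
    tensm (idm X) (lunit Y) \oc assoc X unit_obj Y = tensm (runit X) (idm Y)
}.

Arguments unit_obj {K C} : rename.
Arguments tens {K C} X Y : rename.
Arguments tensm {K C X X' Y Y'} f g : rename.
Arguments assoc {K C} X Y Z : rename.
Arguments assocV {K C} X Y Z : rename.
Arguments lunit {K C} X : rename.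
Arguments runit {K C} X : rename.

Notation "X \ox Y" := (tens X Y) (at level 40, left associativity).
Notation "f \om g" := (tensm f g) (at level 40, left associativity).

Record braided_category (K : fieldType) := BraidedCategory {
  bcat :> monoidal_category K;
  braid : forall X Y : bcat, Hom (X \ox Y) (Y \ox X);
  braid_iso : forall X Y : bcat, is_iso (braid X Y);
  braid_nat : forall (X X' Y Y' : bcat) (f : Hom X X') (g : Hom Y Y'),
    braid X' Y' \oc (f \om g) = (g \om f) \oc braid X Y;
  hexagon1 : forall X Y Z : bcat,
    assoc Y Z X \oc braid X (Y \ox Z) \oc assoc X Y Z =
    (idm Y \om braid X Z) \oc assoc Y X Z \oc (braid X Y \om idm Z);
  hexagon2 : forall X Y Z : bcat,
    assocV Z X Y \oc braid (X \ox Y) Z \oc assocV X Y Z =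
    (braid X Z \om idm Y) \oc assocV X Z Y \oc (idm X \om braid Y Z)
}.

Arguments braid {K C} X Y : rename.

(* [dual X] is a left dual of X; the braiding makes it a right dual as well, so
   that C is rigid.  [twist_dual] states that the twist of [dual X] is the
   transpose of the twist of X. *)
Record ribbon_category (K : fieldType) := RibbonCategory {
  rcat :> braided_category K;
  dual : rcat -> rcat;
  ev : forall X : rcat, Hom (dual X \ox X) unit_obj;
  coev : forall X : rcat, Hom unit_obj (X \ox dual X);
  zigzag : forall X : rcat,
    runit X \oc (idm X \om ev X) \oc assoc X (dual X) X
      \oc (coev X \om idm X) = lunit X;
  zigzag_dual : forall X : rcat,
    lunit (dual X) \oc (ev X \om idm (dual X)) \oc assocV (dual X) X (dual X)
      \oc (idm (dual X) \om coev X) = runit (dual X);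
  twist : forall X : rcat, Hom X X;
  twist_iso : forall X : rcat, is_iso (twist X);
  twist_nat : forall (X Y : rcat) (f : Hom X Y), twist Y \oc f = f \oc twist X;
  twist_tens : forall X Y : rcat,
    twist (X \ox Y) = braid Y X \oc braid X Y \oc (twist X \om twist Y);
  twist_dual : forall X : rcat,
    (twist X \om idm (dual X)) \oc coev X =
    (idm X \om twist (dual X)) \oc coev X
}.

Arguments dual {K C} X : rename.
Arguments ev {K C} X : rename.
Arguments coev {K C} X : rename.
Arguments twist {K C} X : rename.

Record fusion (K : fieldType) (C : ribbon_category K) : Prop := Fusion {
  fusion_abelian : abelian C;
  fusion_semisimple : semisimple C;
  fusion_finite : exists r (X : 'I_r -> C), simple_representatives X;
  fusion_unit : simple (unit_obj : C)
}.

Section ModularData.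
Context {K : fieldType} {C : ribbon_category K}.

Definition qtrace (X : C) (f : Hom X X) : K :=
  scalar_of (ev X \oc braid X (dual X)
               \oc ((twist X \oc f) \om idm (dual X)) \oc coev X).

Definition qdim (X : C) : K := qtrace (idm X).

(* The Hopf link invariants.  The dual on the first index is the convention for
   which s |-> S, t |-> T is a projective representation of SL(2,Z) when
   s = (0,-1;1,0) and t = (1,1;0,1): one has (st)^3 = s^2, and
   (S *m T)^3 is a multiple of S^2 with this convention, but of 1 (which is in
   general not a multiple of S^2) with [X i] in place of [dual (X i)]. *)
Definition Smx r (X : 'I_r -> C) : 'M[K]_r :=
  \matrix_(i, j) qtrace (braid (X j) (dual (X i)) \oc braid (dual (X i)) (X j)).

Definition Tmx r (X : 'I_r -> C) : 'M[K]_r :=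
  diag_mx (\row_i scalar_of (twist (X i))).

End ModularData.

Record modular_category (K : fieldType) := ModularCategory {
  mod_ribbon :> ribbon_category K;
  mod_fusion : fusion mod_ribbon;
  mod_S : forall r (X : 'I_r -> mod_ribbon),
    simple_representatives X -> Smx X \in unitmx
}.

Definition mx22 (a b c d : int) : 'M[int]_2 :=
  \matrix_(i, j) if i == 0 then (if j == 0 then a else b)
                 else (if j == 0 then c else d).

Lemma det_mx22 a b c d : \det (mx22 a b c d) = a * d - b * c.
Proof.
by rewrite (expand_det_row _ ord0) !big_ord_recl big_ord0 addr0 /cofactor
  !det_mx11 !mxE /= !expr0 !expr1 mul1r mulN1r mulrN.
Qed.

Definition SL2Z := {M : 'M[int]_2 | \det M == 1}.
HB.instance Definition _ := Choice.on SL2Z.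

Fact SL2Z_one_subproof : \det (1%:M : 'M[int]_2) == 1.
Proof. by rewrite det1. Qed.

Fact SL2Z_mul_subproof (M N : SL2Z) : \det (val M *m val N) == 1.
Proof. by rewrite det_mulmx (eqP (valP M)) (eqP (valP N)) mulr1. Qed.

Fact SL2Z_inv_subproof (M : SL2Z) : \det (invmx (val M)) == 1.
Proof. by rewrite det_inv (eqP (valP M)) invr1. Qed.

Definition SL2Z_one : SL2Z := exist _ 1%:M SL2Z_one_subproof.
Definition SL2Z_mul (M N : SL2Z) : SL2Z := exist _ (val M *m val N) (SL2Z_mul_subproof M N).
Definition SL2Z_inv (M : SL2Z) : SL2Z := exist _ (invmx (val M)) (SL2Z_inv_subproof M).

Fact SL2Z_unit (M : SL2Z) : val M \in unitmx.
Proof. by rewrite unitmxE (eqP (valP M)) unitr1. Qed.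

Fact SL2Z_mulA : associative SL2Z_mul.
Proof. by move=> M N P; apply: val_inj; rewrite /= mulmxA. Qed.

Fact SL2Z_mul1 : left_id SL2Z_one SL2Z_mul.
Proof. by move=> M; apply: val_inj; rewrite /= mul1mx. Qed.

Fact SL2Z_mulr1 : right_id SL2Z_one SL2Z_mul.
Proof. by move=> M; apply: val_inj; rewrite /= mulmx1. Qed.

Fact SL2Z_mulV : left_inverse SL2Z_one SL2Z_inv SL2Z_mul.
Proof. by move=> M; apply: val_inj; rewrite /= mulVmx ?SL2Z_unit. Qed.

Fact SL2Z_mulrV : right_inverse SL2Z_one SL2Z_inv SL2Z_mul.
Proof. by move=> M; apply: val_inj; rewrite /= mulmxV ?SL2Z_unit. Qed.

HB.instance Definition _ := isGroup.Build SL2Z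
  SL2Z_mulA SL2Z_mul1 SL2Z_mulr1 SL2Z_mulV SL2Z_mulrV.

Fact SL2Z_s_subproof : \det (mx22 0 (-1) 1 0) == 1.
Proof. by rewrite det_mx22. Qed.

Fact SL2Z_t_subproof : \det (mx22 1 1 0 1) == 1.
Proof. by rewrite det_mx22. Qed.

Definition SL2Z_s : SL2Z := exist _ (mx22 0 (-1) 1 0) SL2Z_s_subproof.
Definition SL2Z_t : SL2Z := exist _ (mx22 1 1 0 1) SL2Z_t_subproof.

(* The two laws make every [rho g] invertible, with inverse [rho g^-1]. *)
Record representation (G : groupType) (K : fieldType) (n : nat) :=
  Representation {
    repr_mx :> G -> 'M[K]_n;
    repr_mx1 : repr_mx 1%g = 1%:M;
    repr_mxM : forall g h : G, repr_mx (g * h)%g = repr_mx g *m repr_mx h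
  }.

Section Representation.
Context {G : groupType} {K : fieldType}.

Definition rep_isomorphic m n
    (rho : representation G K m) (sigma : representation G K n) : Prop :=
  exists (P : 'M[K]_(m, n)) (Q : 'M[K]_(n, m)),
    [/\ P *m Q = 1%:M, Q *m P = 1%:M
      & forall g, rho g *m P = P *m sigma g].

Section DirectSum.
Variables (m n : nat).
Variables (rho : representation G K m) (sigma : representation G K n).

Definition dsum_mx (g : G) : 'M[K]_(m + n) :=
  block_mx (rho g) 0 0 (sigma g).

Fact dsum_mx1 : dsum_mx 1%g = 1%:M.
Proof. by rewrite /dsum_mx !repr_mx1 -scalar_mx_block. Qed.

Fact dsum_mxM (g h : G) : dsum_mx (g * h)%g = dsum_mx g *m dsum_mx h.
Proof.
by rewrite /dsum_mx !repr_mxM mulmx_block !mul0mx !mulmx0 !addr0 !add0r.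
Qed.

Definition dsum_rep : representation G K (m + n) :=
  Representation dsum_mx1 dsum_mxM.
End DirectSum.

Section BaseChange.
Variables (n : nat) (L : fieldType) (f : {rmorphism K -> L}).
Variable rho : representation G K n.

Fact map_rep_mx1 : map_mx f (rho 1%g) = 1%:M.
Proof. by rewrite repr_mx1 map_mx1. Qed.

Fact map_rep_mxM (g h : G) :
  map_mx f (rho (g * h)%g) = map_mx f (rho g) *m map_mx f (rho h).
Proof. by rewrite repr_mxM map_mxM. Qed.

Definition map_rep : representation G L n :=
  Representation map_rep_mx1 map_rep_mxM.
End BaseChange.

(* [rho g] acts on column vectors. *)
Definition irreducible_rep n (rho : representation G K n) : Prop :=
  (0 < n)%N /\
  forall U : {vspace 'cV[K]_n},
    (forall (g : G) (v : 'cV[K]_n), v \in U -> rho g *m v \in U) ->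
    U = 0%VS \/ U = fullv.

End Representation.

Definition absolutely_irreducible_rep (G : groupType) (K : fieldType) n
    (rho : representation G K n) : Prop :=
  forall (L : fieldType) (f : {rmorphism K -> L}),
    irreducible_rep (map_rep f rho).

Definition t_spectrum (K : fieldType) n (rho : representation SL2Z K n)
    : pred K :=
  eigenvalue (rho SL2Z_t).

Definition disjoint_t_spectra (K : fieldType) m n
    (rho : representation SL2Z K m) (sigma : representation SL2Z K n) : Prop :=
  forall a : K, ~ (a \in t_spectrum rho /\ a \in t_spectrum sigma).

Definition non_degenerate (K : fieldType) n (rho : representation SL2Z K n)
    : Prop :=
  exists e : n.-tuple K, uniq e /\ e =i t_spectrum rho.

(* The scalars are automatically nonzero, since S, T and the values of rho are
   invertible. *)
Definition modular_representation (K : fieldType) (C : modular_category K) r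
    (X : 'I_r -> C) (rho : representation SL2Z K r) : Prop :=
  (exists a : K, rho SL2Z_s = a *: Smx X) /\
  (exists b : K, rho SL2Z_t = b *: Tmx X).

(* Main.v *)
(* If [rho] were a direct sum with disjoint t-spectra, the diagonal matrix
   [rho SL2Z_t] would force [rho SL2Z_s], hence the S-matrix, to be block
   diagonal; an invariant subspace of a non-degenerate [rho] is likewise spanned
   by basis vectors.  Both are excluded because the row and the column of S at
   the unit object have no zero entry.  Up to the nonzero scalar by which a
   double braiding acts on a simple object, those entries are quantum dimensions
   of simple objects X, and these do not vanish: by semisimplicity the pivotal
   evaluation X \ox dual X -> 1 has a section, and all maps
   1 -> X \ox dual X are multiples of the coevaluation. *)

From HB Require Import structures.
From mathcomp Require Import all_boot all_order all_algebra reals.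
From mathcomp.real_closed Require Import complex.
Require Import Defs.

Set Implicit Arguments.
Unset Strict Implicit.
Unset Printing Implicit Defensive.

Import GRing.Theory VectorInternalTheory.
Local Open Scope ring_scope.

(** * Linear categories and isomorphisms of simple objects *)

Section LinearCategoryTheory.
Context {K : fieldType} {C : linear_category K}.
Implicit Types W X Y Z : C.

HB.instance Definition _ X Y Z (g : Hom Y Z) :=
  GRing.isLinear.Build K (Hom X Y) (Hom X Z) _ (cmp g)
    (fun a f f' => cmp_linearr a g f f').

Lemma cmpDl X Y Z (g g' : Hom Y Z) (f : Hom X Y) :
  (g + g') \oc f = (g \oc f) + (g' \oc f).
Proof. by rewrite -[g]scale1r cmp_linearl !scale1r. Qed.

Lemma cmp0m X Y Z (f : Hom X Y) : (0 : Hom Y Z) \oc f = 0.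
Proof. by apply: (addrI (0 \oc f)); rewrite -cmpDl !addr0. Qed.

Lemma cmpm0 X Y Z (g : Hom Y Z) : g \oc (0 : Hom X Y) = 0.
Proof. exact: linear0. Qed.

Lemma cmpZl X Y Z (a : K) (g : Hom Y Z) (f : Hom X Y) :
  (a *: g) \oc f = a *: (g \oc f).
Proof. by rewrite -[a *: g]addr0 cmp_linearl cmp0m addr0. Qed.

Lemma cmpZr X Y Z (a : K) (g : Hom Y Z) (f : Hom X Y) :
  g \oc (a *: f) = a *: (g \oc f).
Proof. exact: linearZ. Qed.

Lemma cmpBl X Y Z (g g' : Hom Y Z) (f : Hom X Y) :
  (g - g') \oc f = (g \oc f) - (g' \oc f).
Proof. by rewrite -scaleN1r cmpDl cmpZl scaleN1r. Qed.

Lemma cmpBr X Y Z (g : Hom Y Z) (f f' : Hom X Y) :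
  g \oc (f - f') = (g \oc f) - (g \oc f').
Proof. exact: linearB. Qed.

(** For rewriting with a commuting square at the head of a right-nested composite. *)
Lemma cmp_square W X Y Y' Z (p : Hom Y Z) (q : Hom X Y) (p' : Hom Y' Z)
    (q' : Hom X Y') :
  p \oc q = p' \oc q' ->
  forall k : Hom W X, p \oc (q \oc k) = p' \oc (q' \oc k).
Proof. by move=> e k; rewrite !cmpA e. Qed.

Lemma cmp_triangle W X Y Z (p : Hom Y Z) (q : Hom X Y) (r : Hom X Z) :
  p \oc q = r -> forall k : Hom W X, p \oc (q \oc k) = r \oc k.
Proof. by move=> e k; rewrite !cmpA e. Qed.

Lemma is_iso_cmp X Y Z (g : Hom Y Z) (f : Hom X Y) :
  is_iso g -> is_iso f -> is_iso (g \oc f).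
Proof.
move=> [g' [g'K gK']] [f' [f'K fK']]; exists (f' \oc g'); split.
  by rewrite -cmpA (cmp_triangle g'K) cmp1m.
by rewrite -cmpA (cmp_triangle fK') cmp1m.
Qed.

Lemma isomorphic_sym X Y : isomorphic X Y -> isomorphic Y X.
Proof. by move=> [f [g [gf fg]]]; exists g, f. Qed.

Lemma isomorphic_trans Y X Z :
  isomorphic X Y -> isomorphic Y Z -> isomorphic X Z.
Proof.
by move=> [f f_iso] [g g_iso]; exists (g \oc f); apply: is_iso_cmp.
Qed.

Lemma iso_cmp_eq0 X Y Z (g : Hom Y Z) (f : Hom X Y) :
  is_iso g -> g \oc f = 0 -> f = 0.
Proof.
by move=> [g' [g'K _]] gf0; rewrite -[f]cmp1m -g'K -cmpA gf0 cmpm0.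
Qed.

Lemma cmp_iso_eq0 X Y Z (g : Hom Y Z) (f : Hom X Y) :
  is_iso f -> g \oc f = 0 -> g = 0.
Proof.
by move=> [f' [_ fK']] gf0; rewrite -[g]cmpm1 -fK' cmpA gf0 cmp0m.
Qed.

(** The kernel of [f] is a subobject of the simple [X]: were it all of [X], [f] would vanish, so it
    is zero. Hence [f] is mono into the simple [Y]. *)
Lemma simple_nonzero_iso X Y (f : Hom X Y) :
  abelian C -> simple X -> simple Y -> f <> 0 -> is_iso f.
Proof.
move=> abC [nzX simX] [nzY simY] f_nz.
have [Z [k [fk0 kerP]]] := ab_ker abC f.
have k_mono : mono k.
  move=> W g h kgh.
  have [u [_ u_uniq]] : exists! u : Hom W Z, k \oc u = k \oc g.
    by apply: kerP; rewrite cmpA fk0 cmp0m.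
  by rewrite -(u_uniq g erefl) (u_uniq h _).
case: (simX _ _ k_mono) => [Z0 | k_iso]; last first.
  by case: f_nz; exact: cmp_iso_eq0 fk0.
have f_mono : mono f.
  move=> W g h fgh; apply/eqP; rewrite -subr_eq0; apply/eqP.
  have [|u [<- _]] := kerP _ (g - h); first by rewrite cmpBr fgh subrr.
  by rewrite -[k]cmpm1 Z0 cmpm0 cmp0m.
by case: (simY _ _ f_mono).
Qed.

(** The conclusion of Schur's lemma as a property of its own: it passes to isomorphic objects and to
    duals by diagram calculus alone, without discussing subobjects of a dual. *)
Definition brick X : Prop :=
  idm X != 0 /\ forall f : Hom X X, exists a : K, f = a *: idm X.

Lemma brick_scalar_of X (f : Hom X X) : brick X -> f = scalar_of f *: idm X.
Proof.
move=> [nzX brX]; have [a ->] := brX f; congr (_ *: _).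
have idm_free : free [tuple idm X] by rewrite /= seq1_free.
by rewrite /scalar_of linearZ /= (coord_free ord0 ord0 idm_free) mulr1.
Qed.

Lemma brick_isomorphic X Y : isomorphic X Y -> brick Y -> brick X.
Proof.
move=> [f [g [gf fg]]] [nzY brY]; split.
  apply: contra_neq nzY => X0.
  by rewrite -fg -[f]cmpm1 X0 cmpm0 cmp0m.
move=> h; have [a fhg] := brY (f \oc h \oc g); exists a.
by rewrite -[h]cmpm1 -gf -[h]cmp1m -{1}gf -!cmpA [h \oc _]cmpA
  [f \oc (_ \oc g \oc f)]cmpA [f \oc (h \oc g)]cmpA fhg cmpZl cmp1m cmpZr.
Qed.

Lemma brick_iso_scalar X (f : Hom X X) :
  brick X -> is_iso f -> exists2 a : K, a != 0 & f = a *: idm X.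
Proof.
move=> [nzX brX] [g [gf _]]; have [a fE] := brX f; exists a => //.
apply: contra_neq nzX => a0.
by rewrite -gf fE a0 scale0r cmpm0.
Qed.

(* [s \oc p] is a nonzero idempotent in a field of scalars. *)
Lemma brick_retract_iso X Y (p : Hom X Y) (s : Hom Y X) :
  brick X -> idm Y != 0 -> p \oc s = idm Y -> is_iso p.
Proof.
move=> [nzX brX] nzY ps; exists s; split=> //.
have [a spE] := brX (s \oc p).
have sE : s = a *: s by rewrite -[LHS]cmpm1 -ps cmpA spE cmpZl cmp1m.
have aE : idm Y = a *: idm Y by rewrite -ps {1}sE cmpZr.
have: (1 - a) *: idm Y == 0 by rewrite scalerBl scale1r -aE subrr.
rewrite scaler_eq0 (negPf nzY) orbF subr_eq0 => /eqP a1.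
by rewrite spE -a1 scale1r.
Qed.

End LinearCategoryTheory.

(** * Schur's lemma over an algebraically closed field *)

Section Schur.
Context {K : closedFieldType} {C : linear_category K}.

(** Composition with [f] on the nonzero space [Hom X X] has an eigenvalue [a]. Then [f - a *: idm X]
    kills a nonzero map, so it is not an isomorphism and must vanish. *)
Lemma simple_brick (X : C) : abelian C -> simple X -> brick X.
Proof.
move=> abC simX; have [nzX _] := simX.
have nz : idm X != 0 by apply/eqP.
split=> // f.
pose phi := v2r \o @cmp K C X X X f \o r2v.
have dim_gt0 : (0 < dim (Hom X X))%N.
  rewrite lt0n; apply: contra_neq nz => d0.
  apply: (can_inj v2rK); move: (v2r _) (v2r _); rewrite d0 => u v.
  by rewrite (thinmx0 u) (thinmx0 v).
have [a rt_a] : exists a, root (char_poly (lin1_mx phi)) a.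
  by apply/closed_rootP; rewrite size_char_poly eqSS -lt0n.
have /eigenvalueP[u uE u_nz] : eigenvalue (lin1_mx phi) a.
  by rewrite eigenvalue_root_char.
have fu : (f - a *: idm X) \oc r2v u = 0.
  rewrite cmpBl cmpZl cmp1m; apply/eqP; rewrite subr_eq0; apply/eqP.
  by apply: (can_inj v2rK); rewrite linearZ /= r2vK -uE mul_rV_lin1.
exists a; apply/eqP; rewrite -subr_eq0; apply: contraNT u_nz => /eqP fa_nz.
have fa_iso := simple_nonzero_iso abC simX simX fa_nz.
by rewrite -(r2vK u) (iso_cmp_eq0 fa_iso fu) linear0.
Qed.

End Schur.

(** * Tensor products of morphisms and coherence *)

Section MonoidalTheory.
Context {K : fieldType} {C : monoidal_category K}.
Implicit Types W X Y Z : C.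

Lemma tens0m X X' Y Y' (g : Hom Y Y') : (0 : Hom X X') \om g = 0.
Proof.
have := tensm_linearl 1 (0 : Hom X X') 0 g; rewrite !scale1r addr0 => /eqP.
by rewrite -subr_eq subrr eq_sym => /eqP.
Qed.

Lemma tensm0 X X' Y Y' (f : Hom X X') : f \om (0 : Hom Y Y') = 0.
Proof.
have := tensm_linearr 1 f (0 : Hom Y Y') 0; rewrite !scale1r addr0 => /eqP.
by rewrite -subr_eq subrr eq_sym => /eqP.
Qed.

Lemma tensZm X X' Y Y' (a : K) (f : Hom X X') (g : Hom Y Y') :
  (a *: f) \om g = a *: (f \om g).
Proof. by rewrite -[a *: f]addr0 tensm_linearl tens0m addr0. Qed.

Lemma tensmZ X X' Y Y' (a : K) (f : Hom X X') (g : Hom Y Y') :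
  f \om (a *: g) = a *: (f \om g).
Proof. by rewrite -[a *: g]addr0 tensm_linearr tensm0 addr0. Qed.

Lemma tensBm X X' Y Y' (f f' : Hom X X') (g : Hom Y Y') :
  (f - f') \om g = f \om g - f' \om g.
Proof. by rewrite addrC -scaleN1r tensm_linearl scaleN1r addrC. Qed.

Lemma tensmB X X' Y Y' (f : Hom X X') (g g' : Hom Y Y') :
  f \om (g - g') = f \om g - f \om g'.
Proof. by rewrite addrC -scaleN1r tensm_linearr scaleN1r addrC. Qed.

Lemma tensm_iso X X' Y Y' (f : Hom X X') (g : Hom Y Y') :
  is_iso f -> is_iso g -> is_iso (f \om g).
Proof.
move=> [f' [f'K fK']] [g' [g'K gK']]; exists (f' \om g').
by rewrite -!tensm_cmp f'K fK' g'K gK' !tensm1.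
Qed.

Lemma id_iso (X : C) : is_iso (idm X).
Proof. by exists (idm X); rewrite cmp1m. Qed.

Lemma tens_unitl_isomorphic X Y :
  isomorphic X unit_obj -> isomorphic (X \ox Y) Y.
Proof.
move=> [f f_iso]; exists (lunit Y \oc (f \om idm Y)).
by apply: is_iso_cmp; [exact: lunit_iso | apply: tensm_iso (id_iso _)].
Qed.

Lemma tens_unitr_isomorphic X Y :
  isomorphic X unit_obj -> isomorphic (Y \ox X) Y.
Proof.
move=> [f f_iso]; exists (runit Y \oc (idm Y \om f)).
by apply: is_iso_cmp; [exact: runit_iso | apply: tensm_iso (id_iso _) _].
Qed.

Lemma assoc_iso X Y Z : is_iso (assoc X Y Z).
Proof. by exists (assocV X Y Z); rewrite assocK assocVK. Qed.

Lemma assocV_nat X X' Y Y' Z Z' (f : Hom X X') (g : Hom Y Y') (h : Hom Z Z') :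
  assocV X' Y' Z' \oc (f \om (g \om h)) =
  ((f \om g) \om h) \oc assocV X Y Z.
Proof.
rewrite -[LHS]cmpm1 -(assocVK X Y Z) -!cmpA [_ \oc (assoc X Y Z \oc _)]cmpA.
by rewrite -assoc_nat -cmpA (cmp_triangle (assocK _ _ _)) cmp1m.
Qed.

Lemma pentagonV W X Y Z :
  assoc W (X \ox Y) Z \oc ((assoc W X Y \om idm Z) \oc assocV (W \ox X) Y Z) =
  (idm W \om assocV X Y Z) \oc assoc W X (Y \ox Z).
Proof.
rewrite -[LHS]cmp1m -tensm1 -(assocK X Y Z) -[idm W]cmp1m tensm_cmp -cmpA !cmp1m.
by congr (_ \oc _); rewrite !cmpA pentagon -!cmpA assocVK cmpm1.
Qed.

End MonoidalTheory.

(** * Transposition along the duality *)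

Section Duality.
Context {K : fieldType} {C : ribbon_category K}.
Implicit Types V W X Y Z : C.

(** The transpose of [s] is a map [W \ox X -> V]; tensoring it with [dual X] and inserting [coev X]
    gives back [s] up to unit isomorphisms. *)
Lemma coev_transpose_inj V W X (s : Hom W (V \ox dual X)) :
  (idm V \om ev X) \oc assoc V (dual X) X \oc (s \om idm X) = 0 -> s = 0.
Proof.
move=> phis0.
(* Expanding [runit (dual X)] by [zigzag_dual] and sliding [coev X] below [s] makes the transpose of
   [s], which is zero, appear as a factor. *)
have E : (idm V \om runit (dual X)) \oc
    (assoc V (dual X) unit_obj \oc (s \om idm unit_obj)) = 0.
  rewrite -zigzag_dual.
  rewrite -[X in X \om (_ \oc _)]cmp1m tensm_cmp -cmpA.
  rewrite (_ : (idm V \om (idm (dual X) \om coev X)) \oc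
      (assoc V (dual X) unit_obj \oc (s \om idm unit_obj)) =
      assoc V (dual X) (X \ox dual X) \oc ((s \om (idm X \om idm (dual X)))
        \oc (idm W \om coev X))); last first.
    rewrite cmpA -assoc_nat -cmpA tensm1 -!tensm_cmp.
    by rewrite tensm1 !cmp1m !cmpm1.
  rewrite -[X in X \om (_ \oc _)]cmp1m tensm_cmp -cmpA.
  rewrite (cmp_triangle (esym (pentagonV _ _ _ _))) -!cmpA.
  rewrite -[X in X \om (_ \oc _)]cmp1m tensm_cmp -cmpA.
  rewrite (cmp_square (esym (assoc_nat _ _ _))) (cmp_square (assocV_nat _ _ _)).
rewrite [(assoc _ _ _ \om _) \oc (_ \oc _)]cmpA -tensm_cmp.
  rewrite [(_ \om _ \om _) \oc (_ \oc _)]cmpA -tensm_cmp.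
  rewrite -cmpA in phis0; by rewrite !cmp1m phis0 tens0m cmp0m !cmpm0.
have s0 : s \om idm unit_obj = 0.
  apply: (iso_cmp_eq0 (assoc_iso _ _ _)); apply: (iso_cmp_eq0 _ E).
  by apply: tensm_iso (id_iso _) (runit_iso _).
apply: (cmp_iso_eq0 (runit_iso W)).
by rewrite -runit_nat s0 cmpm0.
Qed.

(** By [zigzag_dual] and naturality, [h] can be moved through [ev X] until it meets [coev X]. *)
Lemma coev_post_inj X Y (h : Hom (dual X) Y) :
  (idm X \om h) \oc coev X = 0 -> h = 0.
Proof.
move=> h0; apply: (cmp_iso_eq0 (runit_iso (dual X))).
rewrite -zigzag_dual -!cmpA (cmp_square (esym (lunit_nat h))).
have evh : (idm unit_obj \om h) \oc (ev X \om idm _) =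
    (ev X \om idm _) \oc ((idm _ \om idm _) \om h).
  by rewrite -!tensm_cmp tensm1 !cmp1m !cmpm1.
rewrite (cmp_square evh) (cmp_square (esym (assocV_nat _ _ _))).
by rewrite -tensm_cmp h0 tensm0 !cmpm0.
Qed.

Lemma coev_nonzero X : idm X != 0 -> coev X != 0.
Proof.
apply: contra_neq => coev0; apply: (cmp_iso_eq0 (lunit_iso X)).
by rewrite cmp1m -zigzag coev0 tens0m cmpm0.
Qed.

Lemma ev_nonzero X : idm X != 0 -> ev X != 0.
Proof.
apply: contra_neq => ev0; apply: (cmp_iso_eq0 (lunit_iso X)).
by rewrite cmp1m -zigzag ev0 tensm0 cmpm0 !cmp0m.
Qed.

(* Duality identifies [Hom unit_obj (X \ox dual X)] with [Hom X X]. *)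
Lemma brick_coev_span X (s : Hom unit_obj (X \ox dual X)) :
  brick X -> exists a : K, s = a *: coev X.
Proof.
move=> [_ brX]; have [l [lK Kl]] := lunit_iso X.
(* The transpose of [s] is an endomorphism of [X], hence a scalar [a]; by [zigzag], [coev X]
   transposes to the identity, so [s] and [a *: coev X] have equal transposes. *)
have [a aE] := brX (runit X \oc
  ((idm X \om ev X) \oc assoc X (dual X) X \oc (s \om idm X)) \oc l).
exists a; apply/eqP; rewrite -subr_eq0; apply/eqP.
apply: coev_transpose_inj; apply: (iso_cmp_eq0 (runit_iso X)).
rewrite tensBm tensZm !cmpBr !cmpZr.
rewrite [X in X - _](_ : _ = a *: lunit X); last first.
  by rewrite -[lunit X]cmp1m -cmpZl -aE -[RHS]cmpA lK cmpm1.
by rewrite !cmpA zigzag subrr.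
Qed.

(** Acting on [coev X] embeds the endomorphisms of [dual X] into maps [unit_obj -> X \ox dual X],
    which are all multiples of [coev X]. *)
Lemma brick_dual X : brick X -> brick (dual X).
Proof.
move=> brX; have [nzX _] := brX; split.
  apply: contra_neq (coev_nonzero nzX) => dual0.
  by rewrite -[coev X]cmp1m -tensm1 dual0 tensm0 cmp0m.
move=> g; have [a aE] := brick_coev_span ((idm X \om g) \oc coev X) brX.
exists a; apply/eqP; rewrite -subr_eq0; apply/eqP; apply: coev_post_inj.
by rewrite tensmB cmpBl aE tensmZ tensm1 cmpZl cmp1m subrr.
Qed.

End Duality.

(** * Nonvanishing of quantum dimensions and of the unit row and column of S *)

Section Fusion.
Context {K : closedFieldType} {C : ribbon_category K}.
Hypothesis fusC : fusion C.
Implicit Types X Y : C.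

Lemma brick_unit : brick (unit_obj : C).
Proof. exact: simple_brick (fusion_abelian fusC) (fusion_unit fusC). Qed.

(** By semisimplicity [p] is nonzero on some simple summand, where it is an isomorphism onto the
    unit. *)
Lemma unit_quotient_split X (p : Hom X unit_obj) :
  p != 0 -> exists s : Hom unit_obj X, p \oc s = idm unit_obj.
Proof.
move=> p_nz; have [n [Y [simY [i [q [_ _ iq]]]]]] := fusion_semisimple fusC X.
have [k pi_nz] : exists k, p \oc i k != 0.
  apply/existsP; apply: contraNT p_nz; rewrite negb_exists => /forallP pi0.
  rewrite -[p]cmpm1 -iq linear_sum big1 // => k _.
  by rewrite /= cmpA (eqP (negPn (pi0 k))) cmp0m.
have [g [_ pig]] := simple_nonzero_iso (fusion_abelian fusC) (simY k)
  (fusion_unit fusC) (elimN eqP pi_nz).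
by exists (i k \oc g); rewrite cmpA.
Qed.

Definition pivotal_ev X : Hom (X \ox dual X) unit_obj :=
  ev X \oc braid X (dual X) \oc (twist X \om idm (dual X)).

Lemma pivotal_ev_split X : idm X != 0 ->
  exists s : Hom unit_obj (X \ox dual X), pivotal_ev X \oc s = idm unit_obj.
Proof.
move=> nzX; apply: unit_quotient_split.
apply: contra_neq (ev_nonzero nzX) => pev0.
apply: (cmp_iso_eq0 (braid_iso _ _)); apply: cmp_iso_eq0 pev0.
by apply: tensm_iso (id_iso _); exact: twist_iso.
Qed.

(** A section of [pivotal_ev X] is a multiple of [coev X], so the identity of the unit is a multiple
    of [qdim X]. *)
Lemma qdim_brick_neq0 X : brick X -> qdim X != 0.
Proof.
move=> brX; have [s pevs] := pivotal_ev_split brX.1.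
have [a sE] := brick_coev_span s brX.
have [nz1 _] := brick_unit; apply: contra_neq nz1 => qdim0.
rewrite -pevs sE cmpZr [_ \oc coev X](brick_scalar_of _ brick_unit).
by rewrite /pivotal_ev -[twist X]cmpm1 -/(qtrace _) -/(qdim X) qdim0 scale0r
  scaler0.
Qed.

Lemma qtrace_brick_iso X (f : Hom X X) : brick X -> is_iso f -> qtrace f != 0.
Proof.
move=> brX /(brick_iso_scalar brX)[a a_nz ->].
rewrite /qtrace cmpZr tensZm cmpZr cmpZl /scalar_of linearZ /=.
by rewrite mulf_neq0 //; exact: qdim_brick_neq0.
Qed.

(** Here [dual X] is isomorphic to [X \ox dual X], a brick, and a split map from a brick onto the
    unit is an isomorphism. *)
Lemma dual_unit_isomorphic X :
  isomorphic X unit_obj -> isomorphic (dual X) unit_obj.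
Proof.
move=> X1; have X1d := isomorphic_sym (tens_unitl_isomorphic (dual X) X1).
apply: isomorphic_trans X1d _.
have brX := brick_isomorphic X1 brick_unit.
have [s pevs] := pivotal_ev_split brX.1.
exists (pivotal_ev X); apply: brick_retract_iso pevs; last exact: brick_unit.1.
exact: brick_isomorphic (tens_unitl_isomorphic _ X1) (brick_dual brX).
Qed.

(** Tensoring [Y] with a copy of the unit leaves a brick, on which the double braiding is an
    isomorphism. *)
Lemma qtrace_double_braid_unit_neq0 X Y :
    brick Y -> isomorphic X unit_obj ->
  qtrace (braid Y X \oc braid X Y) != 0 /\
  qtrace (braid X Y \oc braid Y X) != 0.
Proof.
move=> brY X1; split; apply: qtrace_brick_iso.
- exact: brick_isomorphic (tens_unitl_isomorphic _ X1) brY.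
- by apply: is_iso_cmp; exact: braid_iso.
- exact: brick_isomorphic (tens_unitr_isomorphic _ X1) brY.
- by apply: is_iso_cmp; exact: braid_iso.
Qed.

Lemma Smx_unit_neq0 r (X : 'I_r -> C) : simple_representatives X ->
  exists i0, forall j, Smx X i0 j != 0 /\ Smx X j i0 != 0.
Proof.
move=> [simX _ repX]; have [i0 i01] := repX _ (fusion_unit fusC).
have brX j : brick (X j) := simple_brick (fusion_abelian fusC) (simX j).
exists i0 => j; rewrite !mxE; split.
  (* [Smx] dualizes its first index: in the row the dualized object is the unit, in the column it is
     [X j]. *)
  apply: (qtrace_double_braid_unit_neq0 (brX j) _).1.
  exact: dual_unit_isomorphic (isomorphic_sym i01).
apply: (qtrace_double_braid_unit_neq0 (brick_dual (brX j)) _).2.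
exact: isomorphic_sym i01.
Qed.

End Fusion.

(** * Representations in which t acts diagonally *)

Section DiagonalRepresentation.
Context {K : fieldType}.

Lemma repr_mx_neq0 (G : groupType) n (rho : representation G K n) (g : G) :
  (0 < n)%N -> rho g != 0.
Proof.
case: n rho => // n rho _; apply: contra_neq (oner_neq0 'M[K]_n.+1) => rhog0.
by rewrite -[RHS](mul0mx _ (rho g^-1%g)) -rhog0 -repr_mxM mulgV repr_mx1.
Qed.

Lemma eigenvalue_diag_mx n (d : 'rV[K]_n) a :
  (a \in eigenvalue (diag_mx d)) = (a \in codom (d 0)).
Proof.
apply/eigenvalueP/codomP => [[v vd v_nz] | [i ->]].
  have [i vi] : exists i, v 0 i != 0 by apply/rV0Pn.
  exists i; apply: (mulfI vi); rewrite mulrC.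
  by have /rowP/(_ i) := vd; rewrite mul_mx_diag !mxE.
exists (delta_mx 0 i).
  apply/rowP=> j; rewrite mul_mx_diag !mxE eqxx /= mulrC.
  by case: eqVneq => [->|] //; rewrite !mulr0.
by apply/rV0Pn; exists i; rewrite mxE !eqxx oner_neq0.
Qed.

(* [P] is the change of basis and [E] the projection onto the first summand.
   Each row of [P] is an eigenvector of a block-diagonal matrix whose blocks
   have no common eigenvalue, so it lives in one block: thus [E] is diagonal
   with entries in {0, 1}, and commuting with [rho SL2Z_s] makes it scalar. *)
Lemma not_dsum_of_nonzero_row n n1 n2 (rho : representation SL2Z K n)
    (rho1 : representation SL2Z K n1) (rho2 : representation SL2Z K n2)
    (d : 'rV[K]_n) (i0 : 'I_n) :
    rho SL2Z_t = diag_mx d -> (forall j, rho SL2Z_s i0 j != 0) ->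
    (0 < n1)%N -> (0 < n2)%N -> disjoint_t_spectra rho1 rho2 ->
  ~ rep_isomorphic rho (dsum_rep rho1 rho2).
Proof.
move=> tE s_nz n1_gt0 n2_gt0 dis [P [Q [PQ QP PC]]].
pose F : 'M[K]_(n1 + n2) := block_mx 1%:M 0 0 0.
pose E := P *m F *m Q.
have FC g : dsum_rep rho1 rho2 g *m F = F *m dsum_rep rho1 rho2 g.
  by rewrite /= /dsum_mx !mulmx_block !mul0mx !mulmx0 mulmx1 mul1mx !addr0.
have QC g : dsum_rep rho1 rho2 g *m Q = Q *m rho g.
  by rewrite -[LHS]mul1mx -QP -mulmxA (mulmxA P) -PC -!mulmxA PQ mulmx1.
have EC g : rho g *m E = E *m rho g.
  by rewrite /E !mulmxA PC -[_ *m F]mulmxA FC -!mulmxA QC.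
have rowE i : row i E = 0 \/ row i E = row i 1%:M.
  have := PC SL2Z_t => /(congr1 (row i)); rewrite tE row_mul row_diag_mx.
  rewrite -scalemxAl -rowE row_mul -[row i P]hsubmxK.
  set u := lsubmx _; set v := rsubmx _.
  rewrite mul_row_block !mulmx0 addr0 add0r scale_row_mx.
  move=> /eq_row_mx[ut vt].
  have rowEE : row i E = row_mx u 0 *m Q.
    rewrite /E row_mul row_mul -[row i P]hsubmxK mul_row_block.
    by rewrite !mulmx0 !addr0 mulmx1.
  have [u0 | u_nz] := eqVneq u 0; first left.
    by rewrite rowEE u0 row_mx0 mul0mx.
  have [v0 | v_nz] := eqVneq v 0.
    by right; rewrite rowEE -v0 hsubmxK -row_mul PQ.
  by case: (dis (d 0 i)); split; apply/eigenvalueP; [exists u | exists v].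
have {}EE i j : E i j = E i i *+ (i == j).
  case: (rowE i) => /rowP Ei; have := Ei j; have := Ei i; rewrite !mxE => -> ->.
    by rewrite mul0rn.
  by rewrite eqxx mulr1n.
have E_scalar : E = (E i0 i0)%:M.
  apply/matrixP=> i j; rewrite EE [RHS]mxE; congr (_ *+ _).
  (* With [E] diagonal, this entry compares [s i0 i * E i i] with [E i0 i0 * s i0 i]; cancel the
     nonzero [s i0 i]. *)
  have /matrixP/(_ i0 i) := EC SL2Z_s.
  rewrite [(_ *m E) i0 i]mxE [(E *m _) i0 i]mxE.
  rewrite (bigD1 i) //= [X in _ + X]big1 ?addr0 => [|k ki]; last first.
    by rewrite EE (negPf ki) mulr0.
  rewrite (bigD1 i0) //= [X in _ + X]big1 ?addr0 => [|k ki]; last first.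
    by rewrite EE eq_sym (negPf ki) mul0r.
  by rewrite mulrC => /(mulIf (s_nz i)).
have F_scalar : F = (E i0 i0)%:M.
  have <- : Q *m E *m P = F by rewrite /E !mulmxA QP mul1mx -mulmxA QP mulmx1.
  by rewrite {1}E_scalar mul_mx_scalar -scalemxAl QP scalemx1.
(* Both blocks of [F] are nonempty, so the same scalar would be 1 and 0. *)
move: F_scalar; rewrite /F scalar_mx_block => /eq_block_mx[E1 _ _ E2].
have /matrixP/(_ (Ordinal n1_gt0) (Ordinal n1_gt0)) := E1.
have /matrixP/(_ (Ordinal n2_gt0) (Ordinal n2_gt0)) := E2.
rewrite [LHS]mxE [RHS]mxE eqxx mulr1n => <-.
by rewrite !mxE eqxx mul0rn => /eqP; rewrite oner_eq0.
Qed.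

(** Lagrange interpolation: a polynomial in the diagonal matrix isolates the [i]-th coordinate of
    [v]. *)
Lemma diag_stable_delta n (d : 'rV[K]_n) (U : {vspace 'cV[K]_n}) v i :
    injective (d 0) -> (forall w, w \in U -> diag_mx d *m w \in U) ->
  v \in U -> v i 0 != 0 -> delta_mx i 0 \in U.
Proof.
move=> d_inj dU vU vi.
have prodU (s : seq 'I_n) : exists2 w, w \in U &
    forall j, w j 0 = (\prod_(k <- s) (d 0 j - d 0 k)) * v j 0.
  elim: s => [|k s [w wU wE]]; first by exists v => // j; rewrite big_nil mul1r.
  exists (diag_mx d *m w - d 0 k *: w) => [|j].
    by rewrite memvB ?memvZ ?dU.
  by rewrite mul_diag_mx !mxE wE big_cons -mulrBl mulrA.
(* Omitting only [i] kills every other coordinate; at [i] the factors are nonzero since the entries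
   of [d] are distinct. *)
have [w wU wE] := prodU (rem i (enum 'I_n)).
have wi : w i 0 != 0.
  rewrite wE mulf_neq0 // prodf_seq_neq0; apply/allP=> k.
  rewrite mem_rem_uniq ?enum_uniq // inE => /andP[ki _] /=.
  by rewrite subr_eq0 (inj_eq d_inj) eq_sym.
rewrite (_ : delta_mx i 0 = (w i 0)^-1 *: w) ?memvZ //.
apply/colP=> j; rewrite !mxE eqxx andbT.
have [-> | ji] := eqVneq j i; first by rewrite mulVf.
rewrite (wE j) (big_rem j) /= ?subrr ?mul0r ?mulr0 //.
by rewrite mem_rem_uniq ?enum_uniq // inE ji mem_enum.
Qed.

(** A nonzero stable subspace contains some basis vector; the nonzero row of s leads from it to the
    one at [i0], and the nonzero column from there to all others. *)
Lemma irreducible_of_nonzero_cross n (rho : representation SL2Z K n)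
    (d : 'rV[K]_n) (i0 : 'I_n) :
    rho SL2Z_t = diag_mx d -> injective (d 0) ->
    (forall j, rho SL2Z_s i0 j != 0 /\ rho SL2Z_s j i0 != 0) ->
  irreducible_rep rho.
Proof.
move=> tE d_inj s_nz; split=> [|U stU]; first exact: leq_trans (ltn_ord i0).
have deltaU v i : v \in U -> v i 0 != 0 -> delta_mx i 0 \in U.
  by apply: diag_stable_delta d_inj _ => w; rewrite -tE; apply: stU.
have [U0 | U_nz] := eqVneq U 0%VS; [by left | right].
have vU := memv_pick U.
have [i vi] : exists i, vpick U i 0 != 0.
  by apply/cV0Pn; rewrite vpick0.
have col_s j k : (rho SL2Z_s *m (delta_mx j 0 : 'cV_n)) k 0 = rho SL2Z_s k j.
  by rewrite -colE mxE.
have i0U : delta_mx i0 0 \in U.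
  apply: (deltaU (rho SL2Z_s *m delta_mx i 0)); first exact/stU/(deltaU _ _ vU).
  by rewrite col_s; case: (s_nz i).
apply/vspaceP => w; rewrite memvf (matrix_sum_delta w) memv_suml // => j _.
rewrite memv_suml // => k _; rewrite ord1 memvZ //.
apply: (deltaU (rho SL2Z_s *m delta_mx i0 0)); first exact: stU.
by rewrite col_s; case: (s_nz j).
Qed.

End DiagonalRepresentation.

Theorem lemma3p18 (R : realType) (C : modular_category R[i]) (r : nat)
    (X : 'I_r -> C) (hX : simple_representatives X)
    (rho : representation SL2Z R[i] r) (hrho : modular_representation X rho) :
  (forall (n1 n2 : nat)
      (rho1 : representation SL2Z R[i] n1) (rho2 : representation SL2Z R[i] n2),
    (0 < n1)%N -> (0 < n2)%N -> disjoint_t_spectra rho1 rho2 ->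
    ~ rep_isomorphic rho (dsum_rep rho1 rho2))
  /\ (non_degenerate rho -> absolutely_irreducible_rep rho).
Proof.
have [[a sE] [b tE]] := hrho.
have [i0 S_nz] := Smx_unit_neq0 (mod_fusion C) hX.
have a_nz : a != 0.
  have := repr_mx_neq0 rho SL2Z_s (leq_trans (ltn0Sn _) (ltn_ord i0)).
  by apply: contra_neq => a0; rewrite sE a0 scale0r.
have s_nz j : rho SL2Z_s i0 j != 0 /\ rho SL2Z_s j i0 != 0.
  have aS k l : Smx X k l != 0 -> (a *: Smx X) k l != 0.
    by move=> ?; rewrite mxE mulf_neq0.
  by have [? ?] := S_nz j; rewrite sE; split; apply: aS.
pose d := b *: \row_i scalar_of (twist (X i)).
have {}tE : rho SL2Z_t = diag_mx d by rewrite tE /Tmx /d linearZ.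
split=> [n1 n2 rho1 rho2|].
  by apply: (not_dsum_of_nonzero_row (i0 := i0) tE) => j; case: (s_nz j).
move=> [e [e_uniq eE]] L f.
(* The [r] diagonal entries include [r] distinct eigenvalues, so none is repeated. *)
have d_inj : injective (d 0).
  apply/injectiveP; rewrite /injectiveb /dinjectiveb.
  apply: (leq_size_uniq e_uniq) => [x|].
    by rewrite eE /t_spectrum tE eigenvalue_diag_mx.
  by rewrite !size_tuple card_ord.
(* The criterion only concerns equality and vanishing of entries, which a field embedding preserves
   and reflects; so it holds over every extension. *)
refine (@irreducible_of_nonzero_cross _ _ (map_rep f rho) (map_mx f d) i0 _ _ _).
- by rewrite /= tE map_diag_mx.
- by move=> i j; rewrite !mxE => /fmorph_inj; have := @d_inj i j; rewrite !mxE.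
- by move=> j; rewrite /= !mxE !fmorph_eq0.
Qed.
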